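(* Let $F$ be a finite simple graph without isolated nodes that contains the complete graph $K_4$ as a subgraph. Then $F$ is not locally common.
   Context: A kernel is a bounded measurable symmetric function $W:[0,1]^2\to\mathbb{R}$. Let $\mathcal{W}_1$ denote the set of kernels with values in $[-1,1]$. For a finite simple graph $F$ and a kernel $W$, define $$t(F,W)=\int_{[0,1]^{V(F)}}\prod_{ij\in E(F)}W(x_i,x_j)\prod_{i\in V(F)}dx_i .$$ Here $1+U$ and $1-U$ denote the kernels $(x,y)\mapsto 1\pm U(x,y)$, and $\|U\|_\infty$ is the $L_\infty$ norm on $[0,1]^2$. A simple graph $F$ is locally common for perturbation $\varepsilon>0$ if $t(F,1+U)+t(F,1-U)\ge 2$ for every $U\in\mathcal{W}_1$ with $\|U\|_\infty\le\varepsilon$. The graph $F$ is locally common if there is an $\varepsilon>0$ such that $F$ is locally common for perturbation $\varepsilon$. *)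

(* Defs.v *)
(* MathComp / MathComp-Analysis *)
From HB Require Import structures.
From mathcomp Require Import all_boot all_order all_algebra.
From mathcomp Require Import all_classical all_reals all_analysis.

Set Implicit Arguments.
Unset Strict Implicit.
Unset Printing Implicit Defensive.

Import Order.TTheory GRing.Theory Num.Theory.
Import numFieldNormedType.Exports.

Local Open Scope classical_set_scope.
Local Open Scope ring_scope.

Record sgraph (V : finType) := SGraph {
  adj :> rel V;
  adj_sym : symmetric adj;
  adj_irr : irreflexive adj }.

Definition contains_subgraph (VH VF : finType) (F : sgraph VF)
    (H : sgraph VH) : Prop :=
  exists f : VH -> VF, injective f /\ forall i j, H i j -> F (f i) (f j).

Definition no_isolated_node (V : finType) (F : sgraph V) : Prop :=
  forall i, exists j, F i j.

Definition complete_rel (n : nat) : rel 'I_n := fun i j => i != j.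

Lemma complete_rel_sym n : symmetric (@complete_rel n).
Proof. by move=> i j; rewrite /complete_rel eq_sym. Qed.

Lemma complete_rel_irr n : irreflexive (@complete_rel n).
Proof. by move=> i; rewrite /complete_rel eqxx. Qed.

Definition complete_graph (n : nat) : sgraph 'I_n :=
  SGraph (@complete_rel_sym n) (@complete_rel_irr n).

(* Lebesgue measure on [0,1], carried by the whole line *)
Section unit_interval_measure.
Variable R : realType.

Definition unit_measure : set (measurableTypeR R) -> \bar R :=
  mrestr (@lebesgue_measure R) (measurable_itv (`[0, 1] : interval R)).

HB.instance Definition _ := Measure.on unit_measure.

Lemma unit_measure_setT : unit_measure setT = 1%E.
Proof.
rewrite /unit_measure /mrestr setTI lebesgue_measure_itv/= lte_fin ltr01.
by rewrite sube0.
Qed.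

HB.instance Definition _ :=
  Measure_isProbability.Build _ _ _ unit_measure unit_measure_setT.

End unit_interval_measure.
Arguments unit_measure R : clear implicits.

(* The n-fold product of a probability measure, obtained by transporting
   P \x P^n along the isomorphism (x, s) |-> x :: s. *)
Section power_measure.
Context d (T : measurableType d) (R : realType).

Definition tuple_cons (n : nat) (p : T * n.-tuple T) : n.+1.-tuple T :=
  [tuple of p.1 :: p.2].

Lemma measurable_tuple_cons n : measurable_fun [set: T * n.-tuple T] (@tuple_cons n).
Proof. exact: measurable_cons. Qed.

HB.instance Definition _ n :=
  isMeasurableFun.Build _ _ _ _ (@tuple_cons n) (@measurable_tuple_cons n).

Fixpoint power_measure (P : probability T R) (n : nat) :
    probability (n.-tuple T) R :=
  match n with
  | 0 => \d_ ([tuple] : 0.-tuple T)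
  | m.+1 => distribution (P \x power_measure P m)%E (@tuple_cons m)
  end.

End power_measure.

Section graph_densities.
Variable R : realType.

(* lebesgue_measure lives on measurableTypeR R, i.e. R with its Borel sets *)
Local Notation bR := (measurableTypeR R).

Definition unit_itv : set bR := [set` `[0%R, 1%R]].

Definition unit_square : set (bR * bR) := unit_itv `*` unit_itv.

Definition unit_cube (n : nat) : set (n.-tuple bR) :=
  [set x | forall i, unit_itv (tnth x i)].

(* Only the values of W on the unit square are relevant. *)
Definition is_kernel (W : bR * bR -> R) : Prop :=
  [/\ measurable_fun unit_square W,
      (forall x y, unit_square (x, y) -> W (x, y) = W (y, x)) &
      exists M : R, forall p, unit_square p -> `|W p| <= M].

Definition is_kernel1 (W : bR * bR -> R) : Prop :=
  is_kernel W /\ forall p, unit_square p -> -1 <= W p <= 1.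

(* The L_oo norm on the unit square: the product measure below gives measure
   zero to the complement of the square. *)
Definition norm_oo (W : bR * bR -> R) : \bar R :=
  Lnorm (unit_measure R \x unit_measure R)%E +oo%E (EFin \o W).

(* The coordinates of x are indexed by the vertices via enum_rank, and each edge
   {i, j} is taken once, in the orientation given by the enumeration of V;
   since W is symmetric on the square the orientation does not matter. *)
Definition hom_density (V : finType) (F : sgraph V) (W : bR * bR -> R) : R :=
  \int[power_measure (unit_measure R) #|V|]_(x in @unit_cube #|V|)
    \prod_(e : V * V | F e.1 e.2 && (enum_rank e.1 < enum_rank e.2)%N)
      W (tnth x (enum_rank e.1), tnth x (enum_rank e.2)).

Definition locally_common_for (V : finType) (F : sgraph V) (eps : R) : Prop :=
  forall U : bR * bR -> R, is_kernel1 U -> (norm_oo U <= eps%:E)%E ->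
    2 <= hom_density F (fun p => 1 + U p) + hom_density F (fun p => 1 - U p).

Definition locally_common (V : finType) (F : sgraph V) : Prop :=
  exists2 eps : R, 0 < eps & locally_common_for F eps.

End graph_densities.
Arguments unit_cube R n : clear implicits.
Arguments locally_common R {V} F.

(* Main.v *)
Require Import Defs.
From mathcomp Require Import all_boot all_order all_algebra.
From mathcomp Require Import algC zify.
From mathcomp Require Import all_classical all_reals all_analysis.
From mathcomp Require Import ess_sup_inf ring lra.
From mathcomp Require Import fintype finset.

(** Multiplying out over the edges, [t(F, 1 + U) + t(F, 1 - U) - 2] is twice the
    sum of [t(D, U)] over the nonempty edge sets [D] of [F] of even size, so a
    kernel [U] is needed for which the copies of K4 contribute a negative amount
    that outweighs everything else.  Scaling [U] by a small [eps] takes care of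
    the [D] with more than six edges, but works against the [D] with two or four
    edges and does nothing against the others with six: these have to be
    suppressed by the structure of [U].

    Take [U = eps * cos (pi d / 2)], where [d] is the Hamming distance on the
    cube [{0,1}^m] with its uniform measure, transported to the unit interval by
    a step map.  Since the cosine is the mean of [i^d] and [(-i)^d], and both are
    products over the [m] coordinates, [t(D, cos)] is the mean, over all choices
    of a sign for each edge, of [(G / 2^n)^m], where [n] is the number of nodes
    and [G] sums, over all two-colourings of the nodes, the product of [i] or
    [-i] over the edges of [D] that are cut.  The exponent of [i] in this Gauss
    sum is a quadratic form with values modulo 4, whose polar form is the
    Laplacian of [D] modulo 2.  Hence [|G / 2^n|^2] is at most [2^-r], where [r]
    is the rank of that Laplacian ([gauss_sum_norm]).

    The rank is 1 for K4, whose Laplacian modulo 2 is the all-ones matrix, and at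
    least 2 as soon as two distinct nodes that meet [D] are not joined in [D]
    ([card_laplace_kernel4]).  So [|t(D, cos)|] is at most [2^(-m/2)] for
    every nonempty [D], and at most [2^-m] unless [D] is a complete graph; a complete
    graph with an even number, at most six, of edges is a K4
    ([complete_on_card4]).  For K4 itself, [G / 2^n] is 0 or [(1 + i) / 2] or
    [(1 - i) / 2], with fourth power 0 or [-1/4] ([gauss_sum_complete4]), so for
    [m = 4 l] with [l] odd no choice of signs gives a positive contribution and
    [t(K4, cos)] is below a negative multiple of [2^(-m/2)].  Choosing first
    [eps] small in terms of [F], then [l] large, makes the copies of K4 win
    ([finite_counterexample]). *)

Set Implicit Arguments.
Unset Strict Implicit.
Unset Printing Implicit Defensive.

Import Order.TTheory GRing.Theory Num.Theory.
Local Open Scope ring_scope.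

(** * Cuts and flips of two-colourings *)

Section Edges.
Variable V : finType.
Implicit Types (D : {set V * V}) (e : V * V) (u v w : V).
Implicit Types (z y : {ffun V -> bool}).

(** A set of pairs stands for the edge set of a simple graph when it lists each
    edge in one of its two directions only; in particular it has no loops. *)
Definition oriented D := forall u v, (u, v) \in D -> (v, u) \notin D.
Definition incident v e := (e.1 == v) || (e.2 == v).
Definition joined D u v := ((u, v) \in D) || ((v, u) \in D).
Definition complete_on D (S : {set V}) :=
  forall u v, joined D u v = [&& u \in S, v \in S & u != v].
Definition cut z e := z e.1 (+) z e.2.
Definition flip v z : {ffun V -> bool} := [ffun u => (u == v) (+) z u].
Definition xor z y : {ffun V -> bool} := [ffun u => z u (+) y u].

Lemma oriented_neq D e : oriented D -> e \in D -> e.1 != e.2.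
Proof.
case: e => u v Dor /= uvD; apply/eqP => uv; rewrite -uv in uvD.
by have := Dor _ _ uvD; rewrite uvD.
Qed.

Lemma oriented_sub D D' : oriented D -> D' \subset D -> oriented D'.
Proof.
by move=> Dor /subsetP D'D u v /D'D /Dor; apply: contra; exact: D'D.
Qed.

Lemma joinedC D u v : joined D u v = joined D v u.
Proof. by rewrite /joined orbC. Qed.

Lemma joined_neq D u v : oriented D -> joined D u v -> u != v.
Proof.
by move=> Dor /orP[] /(oriented_neq Dor) //=; rewrite eq_sym.
Qed.

Lemma flipK v : involutive (flip v).
Proof. by move=> z; apply/ffunP=> u; rewrite !ffunE addbA addbb. Qed.

Lemma xorK z : involutive (xor z).
Proof. by move=> y; apply/ffunP=> u; rewrite !ffunE addbA addbb. Qed.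

Lemma cut_flip v z e : e.1 != e.2 -> cut (flip v z) e = incident v e (+) cut z e.
Proof.
rewrite /cut /incident !ffunE => e12.
have [e1v|_] := eqVneq e.1 v; have [e2v|_] := eqVneq e.2 v => //=.
- by rewrite e1v e2v eqxx in e12.
- by rewrite addNb.
- by rewrite addbN.
Qed.

Lemma cut_xor z y e : cut (xor z y) e = cut z e (+) cut y e.
Proof. by rewrite /cut !ffunE addbACA. Qed.

(** Flips act transitively on the two-colourings, so a property that they preserve
    need only be checked on one of them. *)
Lemma flip_ind (P : {ffun V -> bool} -> Prop) :
  P [ffun=> false] -> (forall v z, P z -> P (flip v z)) -> forall z, P z.
Proof.
move=> P0 Pflip z.
have [k] := ubnP #|[pred u | z u]|; elim: k z => // k IHk z.
rewrite ltnS => zk; have [u zu|z0] := pickP [pred u | z u].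
  rewrite -(flipK u z); apply/Pflip/IHk; apply: leq_trans zk.
  apply/proper_card/properP; split.
    apply/subsetP => w; rewrite !inE ffunE; have [->|//] := eqVneq w u.
    by move=> _; exact: zu.
  by exists u; rewrite !inE // ffunE eqxx negbK.
suff -> : z = [ffun=> false] by [].
by apply/ffunP => u; rewrite ffunE; have /= := z0 u.
Qed.

(** The edges at [v] correspond to the neighbours of [v]. *)
Lemma big_star (A : Type) (idx : A) (op : Monoid.com_law idx) D v
    (f : V * V -> A) :
  oriented D -> (forall u w, f (u, w) = f (w, u)) ->
  \big[op/idx]_(e in D | incident v e) f e =
  \big[op/idx]_(w | joined D v w) f (v, w).
Proof.
move=> Dor fC; rewrite (bigID (fun e => e.1 == v)) /=.
rewrite [RHS](bigID (fun w => (v, w) \in D)) /=; congr (op _ _).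
  rewrite (reindex_onto (fun w => (v, w)) snd) /=; last first.
    by case=> a b /= /andP[_ /eqP->].
  apply: eq_bigl => w; rewrite /incident /joined !eqxx !andbT /=.
  by case: (_ \in D); rewrite ?andbF.
rewrite (reindex_onto (fun w => (w, v)) fst) /=; last first.
  by case=> a b /= /andP[] /andP[_]; rewrite /incident /= => /orP[->//|/eqP->].
apply: eq_big => [w|w _]; last exact: fC.
rewrite /incident /joined !eqxx !andbT orbT !andbT /=.
have [vwD|_] /= := boolP ((v, w) \in D).
  by rewrite (negbTE (Dor _ _ vwD)).
rewrite andbT; case wvD: (_ \in D) => //=.
by have := oriented_neq Dor wvD.
Qed.

Lemma handshake D :
  oriented D -> (\sum_v #|[set w | joined D v w]| = 2 * #|D|)%N.
Proof.
move=> Dor.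
transitivity (\sum_v \sum_(e in D | incident v e) 1)%N.
  apply: eq_bigr => v _; rewrite (@big_star _ _ addn D v (fun=> 1%N))//.
  by rewrite sum1dep_card.
rewrite (exchange_big_dep (mem D)) /=; last by move=> v e _ /andP[].
rewrite mulnC -sum_nat_const; apply: eq_bigr => e eD.
rewrite sum1dep_card eD /=.
have -> : 2%N = #|[set e.1; e.2]| by rewrite cards2 (oriented_neq Dor eD).
by apply: eq_card => v; rewrite !inE /incident !(eq_sym v).
Qed.

End Edges.

(** * The kernel of the Laplacian modulo 2 *)

Section Kernel.
Variable V : finType.
Implicit Types (D : {set V * V}) (e : V * V) (u v w : V).
Implicit Types (z y : {ffun V -> bool}).

Definition star_parity D v y := \big[addb/false]_(e in D | incident v e) cut y e.

(** [star_parity D v y] is the [v]-th coordinate of the image of [y] under the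
    Laplacian of [D] modulo 2, whose entry at [(v, w)] says whether [v] and [w]
    are joined and whose diagonal holds the degrees. *)
Definition laplace_kernel D : {set {ffun V -> bool}} :=
  [set y | [forall v, ~~ star_parity D v y]].

Lemma star_parity_flip D u v y : oriented D -> u != v ->
  star_parity D v (flip u y) = joined D u v (+) star_parity D v y.
Proof.
move=> Dor uv; rewrite /star_parity.
under eq_bigr => e /andP[eD _] do rewrite (cut_flip _ _ (oriented_neq Dor eD)).
rewrite big_split /=; congr (_ (+) _).
rewrite (@big_star _ _ _ addb D v (incident u))//; last first.
  by move=> a b; rewrite /incident orbC.
rewrite joinedC; under eq_bigr do rewrite /incident /= eq_sym (negbTE uv) /=.
rewrite big_mkcond (bigD1 u) //= eqxx big1 ?addbF => [|w /negbTE->].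
  by case: (joined D v u).
by case: ifP.
Qed.

(** The hypothesis makes [A] and its translate by [u] disjoint inside [B]. *)
Lemma flip_card_le (A B : {set {ffun V -> bool}}) u :
  {in A, forall y, [/\ y \in B, flip u y \in B & flip u y \notin A]} ->
  (2 * #|A| <= #|B|)%N.
Proof.
move=> AB; rewrite mul2n -addnn.
rewrite -[X in (X + _)%N](card_imset _ (inv_inj (flipK u))) -cardsUI.
have -> : flip u @: A :&: A = set0.
  apply/setP => y; rewrite !inE; apply/negP => /andP[/imsetP[x xA ->]].
  by apply/negP; case: (AB x xA).
rewrite cards0 addn0; apply/subset_leq_card/subsetP => y.
by rewrite inE => /orP[/imsetP[x xA ->]|yA]; [case: (AB x xA)|case: (AB y yA)].
Qed.

Lemma card_parity0 D u v : oriented D -> joined D u v ->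
  (2 * #|[set y | ~~ star_parity D v y]| <= 2 ^ #|V|)%N.
Proof.
move=> Dor uv; have -> : (2 ^ #|V|)%N = #|[set: {ffun V -> bool}]|.
  by rewrite cardsT card_ffun card_bool.
apply: (flip_card_le (u := u)) => y; rewrite !inE => yv; split=> //.
by rewrite star_parity_flip ?(joined_neq Dor uv)// uv negbK.
Qed.

Lemma card_laplace_kernel D u v : oriented D -> joined D u v ->
  (2 * #|laplace_kernel D| <= 2 ^ #|V|)%N.
Proof.
move=> Dor uv; apply: leq_trans (card_parity0 Dor uv).
rewrite leq_mul2l /=; apply/subset_leq_card/subsetP => y.
by rewrite !inE => /forallP/(_ v).
Qed.

(** The rows of the Laplacian at [u'] and at [w] are independent: both are nonzero,
    and only the former has a nonzero entry at [u]. *)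
Lemma card_laplace_kernel4 D u u' w w' : oriented D ->
  joined D u u' -> joined D w w' -> u != w -> ~~ joined D u w ->
  (4 * #|laplace_kernel D| <= 2 ^ #|V|)%N.
Proof.
move=> Dor uu' ww' uw nuw; rewrite joinedC in ww'.
apply: leq_trans (card_parity0 Dor ww').
rewrite -[4%N]/(2 * 2)%N -mulnA leq_mul2l /=.
apply: (flip_card_le (u := u)) => y.
rewrite !inE => /forallP yK; rewrite yK; split=> //.
  by rewrite star_parity_flip ?(negbTE nuw) ?yK.
apply/negP => /forallP/(_ u').
rewrite star_parity_flip ?(joined_neq Dor uu')// uu' addTb negbK.
by rewrite (negbTE (yK _)).
Qed.

End Kernel.

(** * Gauss sums of edge sets *)

Section Gauss.
Variables (V : finType) (C : numClosedFieldType).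
Implicit Types (D : {set V * V}) (e : V * V) (u v w : V).
Implicit Types (z y : {ffun V -> bool}) (s : V * V -> bool).

(** A primitive fourth root of unity; the sign [b] is chosen separately for each
    edge when the cosine is split into two exponentials. *)
Definition quarter (b : bool) : C := if b then - 'i else 'i.
Definition phase D s z := \prod_(e in D) quarter (s e) ^+ cut z e.
Definition gauss_sum D s := \sum_z phase D s z.

Lemma quarter_sqr b : quarter b ^+ 2 = -1.
Proof. by case: b; rewrite /quarter ?sqrrN sqrCi. Qed.

Lemma quarter_conj b : (quarter b)^* = - quarter b.
Proof. by case: b; rewrite /quarter ?rmorphN /= conjCi ?opprK. Qed.

Lemma quarter_norm b : `|quarter b| = 1.
Proof. by case: b; rewrite /quarter ?normrN normCi. Qed.

Lemma star_parity_sign D v z :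
  (-1) ^+ star_parity D v z =
  \prod_(e in D | incident v e) (-1) ^+ cut z e :> C.
Proof.
apply: (big_morph (fun b : bool => (-1) ^+ b : C)) => //.
exact: signr_addb.
Qed.

(** The product on the right couples [y] and [z] through the polar form of the
    quadratic form in the exponent of [phase]. *)
Lemma phase_conj_xor D s z y :
  phase D s z * (phase D s (xor z y))^* =
  (phase D s y)^* * \prod_(e in D) (-1) ^+ (cut y e && cut z e).
Proof.
rewrite /phase !rmorph_prod -!big_split /=; apply: eq_bigr => e _.
rewrite cut_xor !rmorphXn /= quarter_conj.
have q2 := quarter_sqr (s e); rewrite expr2 in q2.
by case: (cut z e); case: (cut y e);
  rewrite /= !(expr0, expr1, mul1r, mulr1, mulrN, mulNr, q2, opprK).
Qed.

(** [H] is the sum of a character of the group of two-colourings; it vanishes as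
    soon as the character is nontrivial on some flip. *)
Lemma char_sum_flip D y v : oriented D ->
  let H := \sum_z \prod_(e in D) (-1) ^+ (cut y e && cut z e) : C in
  H = (-1) ^+ star_parity D v y * H.
Proof.
move=> Dor /=; rewrite {1}(reindex_inj (inv_inj (flipK v))) mulr_sumr.
apply: eq_bigr => z _; rewrite star_parity_sign.
rewrite [X in X * _]big_mkcondr -big_split /=; apply: eq_bigr => e eD.
rewrite cut_flip ?(oriented_neq Dor eD)//.
by case: incident; case: (cut y e); case: (cut z e);
  rewrite /= !(expr0, expr1, mul1r, mulr1, mulrNN).
Qed.

(** As for any Gauss sum: expand the square, substitute the second colouring by its
    difference [y] with the first, and sum over the first.  Only the [y] in the
    radical of the polar form survive, each with a term of modulus [2^n]. *)
Lemma gauss_sum_norm D s : oriented D ->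
  `|gauss_sum D s| ^+ 2 <= (2 ^ #|V| * #|laplace_kernel D|)%:R.
Proof.
move=> Dor; rewrite -[_ ^+ 2]ger0_norm ?exprn_ge0// normCK /gauss_sum.
rewrite rmorph_sum mulr_suml.
under eq_bigr => z _.
  rewrite mulr_sumr (reindex_inj (inv_inj (xorK z))).
  under eq_bigr do rewrite phase_conj_xor.
  over.
rewrite exchange_big /=.
apply: (@le_trans _ _ (\sum_(y in laplace_kernel D) (2 ^ #|V|)%:R)); last first.
  by rewrite sumr_const natrM mulr_natr.
rewrite [leRHS]big_mkcond; apply: le_trans (ler_norm_sum _ _ _) _.
apply: ler_sum => y _.
rewrite -mulr_sumr normrM norm_conjC normr_prod big1 ?mul1r; last first.
  by move=> e _; rewrite normrX quarter_norm expr1n.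
rewrite inE; case: forallP => [_|/forallP/forallPn[v]].
  apply: le_trans (ler_norm_sum _ _ _) _.
  rewrite (le_trans (ler_sum _ (G := fun=> 1) _))//; last first.
    by rewrite sumr_const card_ffun card_bool.
  by move=> z _; rewrite normr_prod big1 // => e _; rewrite normr_sign.
rewrite negbK => yv; have /= := char_sum_flip y v Dor; rewrite yv expr1 mulN1r.
by move=> /eqP; rewrite eq_sym eqNr => /eqP->; rewrite normr0.
Qed.

Lemma gauss_sum_le2 D s u v : oriented D -> joined D u v ->
  2 * `|gauss_sum D s| ^+ 2 <= (2 ^ #|V|)%:R ^+ 2.
Proof.
move=> Dor uv; have := gauss_sum_norm s Dor.
rewrite -(ler_pM2l (ltr0n _ 2%N)) => /le_trans; apply.
rewrite -natrM -natrX ler_nat mulnCA expnS expn1 leq_mul2l.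
by rewrite (card_laplace_kernel Dor uv) orbT.
Qed.

Lemma gauss_sum_le4 D s u u' w w' : oriented D ->
  joined D u u' -> joined D w w' -> u != w -> ~~ joined D u w ->
  4 * `|gauss_sum D s| ^+ 2 <= (2 ^ #|V|)%:R ^+ 2.
Proof.
move=> Dor uu' ww' uw nuw; have := gauss_sum_norm s Dor.
rewrite -(ler_pM2l (ltr0n _ 4%N)) => /le_trans; apply.
rewrite -natrM -natrX ler_nat mulnCA expnS expn1 leq_mul2l.
by rewrite (card_laplace_kernel4 Dor uu' ww' uw nuw) orbT.
Qed.

End Gauss.

(** * Edge sets of complete graphs *)

Section Clique.
Variables (V : finType) (C : numClosedFieldType).
Implicit Types (D : {set V * V}) (S : {set V}) (e : V * V) (u v w : V).
Implicit Types (z y : {ffun V -> bool}) (s : V * V -> bool).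

Local Notation quarter := (quarter C).
Local Notation phase := (phase C).
Local Notation gauss_sum := (gauss_sum C).

Definition star_phase D s v := \prod_(e in D | incident v e) quarter (s e).

Lemma phase_flip D s v z : oriented D ->
  phase D s (flip v z) =
  star_phase D s v * (-1) ^+ star_parity D v z * phase D s z.
Proof.
move=> Dor; rewrite star_parity_sign /star_phase -big_split /=.
rewrite [X in X * _]big_mkcondr -big_split /=.
apply: eq_bigr => e eD; rewrite cut_flip ?(oriented_neq Dor eD)//.
have q2 := quarter_sqr C (s e); rewrite expr2 in q2.
by case: incident; case: (cut z e);
  rewrite /= !(expr0, expr1, mul1r, mulr1, mulrN, mulNr, q2, opprK).
Qed.

Definition parity S z := \big[addb/false]_(w in S) z w.

Lemma parity_flip S v z : parity S (flip v z) = (v \in S) (+) parity S z.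
Proof.
rewrite /parity; under eq_bigr do rewrite ffunE.
rewrite big_split /=; congr (_ (+) _).
case: (boolP (v \in S)) => vS; last first.
  by rewrite big1 // => w wS; apply: contraNF vS => /eqP<-.
by rewrite (bigD1 v) //= eqxx big1 ?addbF // => w /andP[_ /negbTE].
Qed.

Lemma sum_parity_sign S v : v \in S -> \sum_z (-1) ^+ parity S z = 0 :> C.
Proof.
move=> vS; set X := LHS; suff /eqP : X = - X by rewrite eq_sym eqNr => /eqP.
rewrite {1}/X (reindex_inj (inv_inj (flipK v))) -sumrN.
by apply: eq_bigr => z _; rewrite parity_flip vS addTb signrN.
Qed.

Section CompleteOn4.
Variables (D : {set V * V}) (S : {set V}).
Hypotheses (Dor : oriented D) (DS : complete_on D S) (S4 : #|S| = 4%N).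

Lemma complete_on_degree v : v \in S -> #|[set w | joined D v w]| = 3%N.
Proof.
move=> vS; have := cardsD1 v S; rewrite S4 vS add1n => -[->].
by apply: eq_card => w; rewrite !inE DS vS eq_sym /= andbC.
Qed.

(** The Laplacian of K4 modulo 2 is the all-ones matrix, because the degrees are
    odd: every node of [S] sees the same linear form. *)
Lemma star_parity_complete v z : v \in S -> star_parity D v z = parity S z.
Proof.
move=> vS; rewrite /star_parity (@big_star _ _ _ addb D v (cut z))//; last first.
  by move=> a b; rewrite /cut addbC.
transitivity (\big[addb/false]_(w in S) (z v (+) z w)).
  rewrite [RHS](bigD1 v) //= addbb addFb; apply: eq_bigl => w.
  by rewrite DS vS eq_sym.
by rewrite big_split /= big_const S4 /= -/(parity S z); case: (z v).
Qed.

Lemma incident_complete v e : e \in D -> incident v e -> v \in S.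
Proof.
case: e => a b abD; have : joined D a b by rewrite /joined abD.
by rewrite DS /incident => /and3P[aS bS _] /orP[] /= /eqP<-.
Qed.

(** Each node of a K4 has three edges, so the square is [(-1)^3]. *)
Lemma star_phase_sqr s v : v \in S -> star_phase D s v ^+ 2 = -1.
Proof.
move=> vS; rewrite -prodrXl; under eq_bigr do rewrite quarter_sqr.
rewrite (@big_star _ _ _ *%R D v (fun=> -1))//.
rewrite -(eq_bigl _ _ (in_set (fun w => joined D v w))).
by rewrite prodr_const complete_on_degree// -signr_odd expr1.
Qed.

(** The difference made by flipping both [u] and [v] lies in the radical of the
    polar form, so all terms are multiplied by the same constant, and it is 1 only
    if the two star phases agree. *)
Lemma gauss_sum_unbalanced s u v : u \in S -> v \in S ->
  star_phase D s u != star_phase D s v -> gauss_sum D s = 0.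
Proof.
move=> uS vS uv; set c := - (star_phase D s u * star_phase D s v).
have c1 : c != 1.
  apply: contra_neq uv => /(congr1 (fun x => x * star_phase D s v)).
  by rewrite /c mulNr -mulrA -expr2 (star_phase_sqr _ vS) mulrN1 opprK mul1r.
have : gauss_sum D s = c * gauss_sum D s.
  rewrite {1}/gauss_sum (reindex_inj (inv_inj (flipK u))).
  rewrite (reindex_inj (inv_inj (flipK v))) mulr_sumr; apply: eq_bigr => z _.
  rewrite !phase_flip // !star_parity_complete // parity_flip vS addTb signrN.
  rewrite /c; case: (parity S z); rewrite ?expr0 ?expr1; ring.
move=> /eqP; rewrite -subr_eq0 -{1}(mul1r (gauss_sum D s)) -mulrBl mulf_eq0.
by rewrite subr_eq0 eq_sym (negbTE c1) => /eqP.
Qed.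

(** When all star phases are equal to [c], which is [i] or [-i], a flip at a node of
    [S] multiplies the phase by [c] or [-c] according to the parity of the colouring
    on [S].  So the phase is 1 on even and [c] on odd colourings, and
    [G = 2^n (1 + c) / 2]. *)
Lemma gauss_sum_balanced s c : {in S, forall v, star_phase D s v = c} ->
  4 * gauss_sum D s ^+ 4 = - (2 ^ #|V|)%:R ^+ 4.
Proof.
move=> sc; have [v0 v0S] : exists v, v \in S by apply/card_gt0P; rewrite S4.
have c2 : c ^+ 2 = -1 by rewrite -(sc _ v0S) star_phase_sqr.
have phaseE z : phase D s z = if parity S z then c else 1.
  elim/flip_ind: z => [|v z IHz].
    rewrite /phase /parity !big1 // => [v _|e _]; first by rewrite ffunE.
    by rewrite /cut !ffunE expr0.
  rewrite phase_flip // parity_flip; have [vS|vS] := boolP (v \in S).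
    rewrite sc // star_parity_complete // IHz.
    case: (parity S z) => /=; last by rewrite !mulr1.
    by rewrite expr1 mulrN1 mulNr -expr2 c2 opprK.
  have noe e : (e \in D) && incident v e = false.
    by apply/negP => /andP[eD /(incident_complete eD)]; apply/negP.
  by rewrite /star_phase /star_parity !big_pred0 // expr0 !mul1r.
have G2 : 2 * gauss_sum D s = (2 ^ #|V|)%:R * (1 + c).
  transitivity (\sum_z ((1 + c) + (1 - c) * (-1) ^+ parity S z)).
    rewrite mulr_sumr; apply: eq_bigr => z _; rewrite phaseE.
    by case: parity; rewrite ?expr0 ?expr1; ring.
  rewrite big_split /= -mulr_sumr (sum_parity_sign v0S) mulr0 addr0.
  by rewrite sumr_const card_ffun card_bool -[LHS]mulr_natl.
have c4 : (1 + c) ^+ 4 = -4.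
  have -> : (1 + c) ^+ 4 = (1 + c ^+ 2 + 2 * c) ^+ 2 by ring.
  by rewrite c2 subrr add0r exprMn c2; ring.
apply: (mulfI (x := 4)); first by rewrite pnatr_eq0.
transitivity ((2 * gauss_sum D s) ^+ 4); first by ring.
by rewrite G2 exprMn c4; ring.
Qed.

Lemma gauss_sum_complete4 s :
  gauss_sum D s = 0 \/ 4 * gauss_sum D s ^+ 4 = - (2 ^ #|V|)%:R ^+ 4.
Proof.
have [v0 v0S] : exists v, v \in S by apply/card_gt0P; rewrite S4.
have [/forall_inP sc|] :=
  boolP [forall v in S, star_phase D s v == star_phase D s v0].
  by right; apply: (gauss_sum_balanced (c := star_phase D s v0)) => v /sc /eqP.
by move=> /forall_inPn[v vS ne]; left; apply: gauss_sum_unbalanced ne.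
Qed.

Lemma gauss_sum_complete4_constant :
  4 * gauss_sum D (fun=> false) ^+ 4 = - (2 ^ #|V|)%:R ^+ 4.
Proof.
apply: (gauss_sum_balanced (c := 'i ^+ 3)) => v vS.
rewrite /star_phase (@big_star _ _ _ *%R D v (fun=> 'i))//.
rewrite -(eq_bigl _ _ (in_set (fun w => joined D v w))).
by rewrite prodr_const complete_on_degree.
Qed.

End CompleteOn4.

(** With [s] nodes there are [s (s - 1) / 2] edges; among the values 1, 3, 6 that
    are positive and at most 6, only 6 is even. *)
Lemma complete_on_card4 D S : oriented D -> complete_on D S -> D != set0 ->
  ~~ odd #|D| -> (#|D| <= 6)%N -> #|S| = 4%N.
Proof.
move=> Dor DS D0 Dodd D6.
have : (#|S| * #|S|.-1 = 2 * #|D|)%N.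
  rewrite -(handshake Dor) (bigID (mem S)) /= [X in (_ + X)%N]big1 ?addn0.
    rewrite -sum_nat_const; apply: eq_bigr => v vS.
    rewrite (cardsD1 v S) vS; apply: eq_card => w.
    by rewrite !inE DS vS eq_sym /= andbC.
  move=> v vS; apply: eq_card0 => w; rewrite !inE DS.
  by rewrite (negbTE vS).
rewrite -card_gt0 in D0; move: D0 Dodd D6.
move: #|S| #|D| => a b b0 bo b6.
have a5 : (a < 5 \/ 5 <= a)%N by lia.
case: a5 => [|a5]; last by nia.
by case: a => [|[|[|[|[|//]]]]] _ /=; lia.
Qed.

Lemma complete_or_nonjoined D : oriented D ->
  (exists S, complete_on D S) \/
  exists u u' w w', [/\ joined D u u', joined D w w', u != w & ~~ joined D u w].
Proof.
move=> Dor; pose S := [set u | [exists u', joined D u u']].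
have [/forall_inP H|] :=
  boolP [forall u in S, forall w in S, (u != w) ==> joined D u w].
  left; exists S => u w; apply/idP/and3P => [uw|[uS wS uw]].
    split; last exact: joined_neq uw.
      by rewrite inE; apply/existsP; exists w.
    by rewrite inE; apply/existsP; exists u; rewrite joinedC.
  by have /forall_inP/(_ _ wS)/implyP/(_ uw) := H _ uS.
move=> /forall_inPn[u uS] /forall_inPn[w wS]; rewrite negb_imply => /andP[uw nuw].
right; move: uS wS; rewrite !inE => /existsP[u' uu'] /existsP[w' ww'].
by exists u, u', w, w'.
Qed.

End Clique.

(** * The cosine kernel on the cube *)

(** The homomorphism density of [D] in the weighted graph [w], without the
    normalisation by the number of maps. *)
Definition hom_sum (A : comPzRingType) (V X : finType) (D : {set V * V})
    (w : X -> X -> A) : A :=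
  \sum_(s : {ffun V -> X}) \prod_(e in D) w (s e.1) (s e.2).

Definition hamming m (x y : {ffun 'I_m -> bool}) : nat :=
  (\sum_k (x k (+) y k))%N.

(** The cosine of [d] quarter turns. *)
Definition cos_quarter (d : nat) : int := if odd d then 0 else (-1) ^+ d./2.

Definition hamming_cos m (x y : {ffun 'I_m -> bool}) : int :=
  cos_quarter (hamming x y).

Lemma hamming_cosC m (x y : {ffun 'I_m -> bool}) :
  hamming_cos x y = hamming_cos y x.
Proof. by congr cos_quarter; apply: eq_bigr => k _; rewrite addbC. Qed.

Lemma hamming_cos_norm m (x y : {ffun 'I_m -> bool}) : `|hamming_cos x y| <= 1.
Proof.
by rewrite /hamming_cos /cos_quarter; case: odd; rewrite ?normr0// normr_sign.
Qed.

Lemma cos_quarterE (C : numClosedFieldType) d :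
  2 * (cos_quarter d)%:~R = \sum_b quarter C b ^+ d.
Proof.
rewrite /cos_quarter.
move: (odd_double_half d); move: (odd d) d./2 => b h <-.
have quarterX c : quarter C c ^+ (b + h.*2) = quarter C c ^+ b * (-1) ^+ h.
  by rewrite exprD -mul2n exprM quarter_sqr.
rewrite big_bool !quarterX /quarter /= -mulrDl.
case: b {quarterX}; rewrite /= ?expr0 ?expr1; first by rewrite mulr0 addNr mul0r.
by rewrite rmorphXn /= rmorphN1.
Qed.

Section Density.
Variables (V : finType) (C : numClosedFieldType) (D : {set V * V}).

Lemma phase_tensor m s (x : {ffun V -> {ffun 'I_m -> bool}}) :
  \prod_(e in D) quarter C (s e) ^+ hamming (x e.1) (x e.2) =
  \prod_k phase C D s [ffun v => x v k].
Proof.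
rewrite /phase [RHS]exchange_big; apply: eq_bigr => e _ /=.
rewrite /hamming expr_sum; apply: eq_bigr => k _.
by rewrite /cut !ffunE.
Qed.

(** The kernel is a tensor power, so the sum over maps to the cube factors into
    [m] equal sums over maps to a single bit. *)
Lemma gauss_sum_tensor m s :
  \sum_(x : {ffun V -> {ffun 'I_m -> bool}})
     \prod_(e in D) quarter C (s e) ^+ hamming (x e.1) (x e.2) =
  gauss_sum C D s ^+ m.
Proof.
rewrite -[m in RHS]card_ord -prodr_const /gauss_sum.
rewrite (eq_bigl xpredT)// bigA_distr_bigA /=.
pose tr (f : {ffun 'I_m -> {ffun V -> bool}}) :=
  [ffun v => [ffun k => f k v]] : {ffun V -> {ffun 'I_m -> bool}}.
rewrite (reindex tr) /=; last first.
  exists (fun x : {ffun V -> {ffun _ -> bool}} =>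
            [ffun k => [ffun v => x v k]]) => x _;
    by apply/ffunP => a; apply/ffunP => b; rewrite !ffunE.
apply: eq_bigr => f _; rewrite phase_tensor; apply: eq_bigr => k _.
by congr phase; apply/ffunP => v; rewrite !ffunE.
Qed.

(** Each factor is a mean of two exponentials; expand the product of these means.
    Signs are attached to all pairs of nodes, so that the number of sign choices is
    the same for every [D]. *)
Lemma hom_sum_gauss m :
  2 ^+ #|{: V * V}| * (hom_sum D (@hamming_cos m))%:~R =
  \sum_(s : {ffun V * V -> bool}) gauss_sum C D s ^+ m.
Proof.
under [RHS]eq_bigr do rewrite -gauss_sum_tensor.
rewrite exchange_big /= rmorph_sum mulr_sumr; apply: eq_bigr => x _.
rewrite rmorph_prod [X in _ * X]big_mkcond /= -prodr_const (eq_bigl xpredT)//.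
rewrite -big_split /=.
under [RHS]eq_bigr do rewrite big_mkcond /=.
rewrite -(bigA_distr_bigA (fun e b =>
  if e \in D then quarter C b ^+ hamming (x e.1) (x e.2) else 1)) /=.
apply: eq_bigr => e _; case: ifP => _; first by rewrite /hamming_cos cos_quarterE.
by rewrite big_bool mulr1.
Qed.

Lemma hom_sum_bound (a k : nat) :
  (forall s, a%:R * `|gauss_sum C D s| ^+ 2 <= (2 ^ #|V|)%:R ^+ 2) ->
  a%:Z ^+ k * `|hom_sum D (@hamming_cos (2 * k))| <= (2 ^ #|V|)%:Z ^+ (2 * k).
Proof.
move=> aG; rewrite -(ler_int C) !rmorphM !rmorphXn /= intr_norm.
have := hom_sum_gauss (2 * k); set T := (hom_sum _ _)%:~R => TE.
have M0 : 0 < 2 ^+ #|{: V * V}| :> C by rewrite exprn_gt0.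
rewrite -(ler_pM2l M0) mulrCA -[X in X * `|T|]gtr0_norm// -normrM TE.
apply: (@le_trans _ _ (\sum_(s : {ffun V * V -> bool}) (2 ^ #|V|)%:R ^+ (2 * k))).
  apply: (@le_trans _ _ (\sum_(s : {ffun V * V -> bool})
      (a%:R * `|gauss_sum C D s| ^+ 2) ^+ k)).
    under [X in _ <= X]eq_bigr do rewrite exprMn -exprM -normrX.
    by rewrite -mulr_sumr ler_wpM2l// ?exprn_ge0 ?ler_norm_sum.
  apply: ler_sum => s _; rewrite exprM; apply: lerXn2r (aG s).
    by rewrite nnegrE mulr_ge0 ?exprn_ge0.
  by rewrite nnegrE exprn_ge0.
rewrite sumr_const card_ffun card_bool -[leLHS]mulr_natl.
by rewrite [X in X * _ <= _]natrX.
Qed.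

End Density.

Section DensityInt.
Variables (V : finType) (D : {set V * V}).
Local Notation T m := (hom_sum D (@hamming_cos m)).

Lemma hom_sum_le2 k u v : oriented D -> joined D u v ->
  2 ^+ k * `|T (2 * k)| <= (2 ^ #|V|)%:Z ^+ (2 * k).
Proof.
move=> Dor uv; apply: (@hom_sum_bound V algC D 2) => s.
exact: gauss_sum_le2 uv.
Qed.

Lemma hom_sum_le4 k u u' w w' : oriented D ->
  joined D u u' -> joined D w w' -> u != w -> ~~ joined D u w ->
  4 ^+ k * `|T (2 * k)| <= (2 ^ #|V|)%:Z ^+ (2 * k).
Proof.
move=> Dor uu' ww' uw nuw.
by apply: (@hom_sum_bound V algC D 4) => s; apply: gauss_sum_le4 uu' ww' uw nuw.
Qed.

(** No choice of signs contributes a positive amount, and the constant choice alone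
    contributes the right-hand side. *)
Lemma hom_sum_complete4 (l : nat) S : odd l ->
  oriented D -> complete_on D S -> #|S| = 4%N ->
  2 ^+ #|{: V * V}| * (4 ^+ l * T (4 * l)) <= - (2 ^ #|V|)%:Z ^+ (4 * l).
Proof.
move=> lo Dor DS S4; set N := (2 ^ #|V|)%N.
have G0 (x : algC) : 4 * x ^+ 4 = - N%:R ^+ 4 ->
    4 ^+ l * x ^+ (4 * l) = - N%:R ^+ (4 * l).
  move=> xE; rewrite exprM -exprMn xE exprNn -signr_odd lo expr1 mulN1r.
  by rewrite -exprM.
rewrite -(ler_int algC) mulrCA !rmorphM rmorphN !rmorphXn /=.
rewrite hom_sum_gauss mulr_sumr.
rewrite (bigD1 [ffun=> false]) //= -[leRHS]addr0; apply: lerD.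
  rewrite G0 // -(gauss_sum_complete4_constant algC Dor DS S4).
  congr (4 * _ ^+ 4); apply: eq_bigr => z _; apply: eq_bigr => e _.
  by rewrite ffunE.
apply: sumr_le0 => s _; have [->|/G0->] := gauss_sum_complete4 algC Dor DS S4 s.
  by rewrite expr0n muln_eq0 /=; case: l lo {G0} => //= l _; rewrite mulr0.
by rewrite oppr_le0 exprn_ge0.
Qed.

End DensityInt.

(** * The negative even part of the edge expansion *)

Section Expansion.
Variables (A : comPzRingType) (V X : finType).
Implicit Types (D E : {set V * V}) (w : X -> X -> A).

Lemma hom_sum_expand E w a : hom_sum E (fun x y => 1 + a * w x y) =
  \sum_(D : {set V * V} | D \subset E) a ^+ #|D| * hom_sum D w.
Proof.
under [RHS]eq_bigr do rewrite mulr_sumr.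
rewrite exchange_big /=; apply: eq_bigr => x _.
transitivity (\prod_e ((if e \in E then a * w (x e.1) (x e.2) else 0) + 1)).
  rewrite big_mkcond; apply: eq_bigr => e _.
  by case: ifP; rewrite ?add0r // addrC.
rewrite bigA_distr [RHS]big_mkcond /=; apply: eq_bigr => D _.
case: ifPn => [DE|/subsetPn[e eD eE]]; last first.
  by rewrite (bigD1 e) //= eD (negbTE eE) mul0r.
rewrite -big_mkcond -prodr_const -big_split /=.
by apply: eq_bigr => e /(subsetP DE) ->.
Qed.

Lemma hom_sum_rmorph (B : comPzRingType) (h : {rmorphism A -> B}) D w :
  hom_sum D (fun x y => h (w x y)) = h (hom_sum D w).
Proof.
by rewrite /hom_sum rmorph_sum; apply: eq_bigr => x _; rewrite rmorph_prod.
Qed.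

Lemma hom_sum0 w : hom_sum (set0 : {set V * V}) w = (#|X| ^ #|V|)%:R.
Proof.
rewrite /hom_sum -card_ffun -sumr_const; apply: eq_bigr => x _.
by rewrite big_set0.
Qed.

End Expansion.

Lemma PoszX (n k : nat) : (n ^ k)%N%:Z = n%:Z ^+ k.
Proof. by rewrite -natz natrX natz. Qed.

Section FiniteCounterexample.
Variables (R : archiRealFieldType) (V : finType).
Implicit Types (D : {set V * V}) (S : {set V}).

Let M := #|{: V * V}|.

(** The homomorphism density of [D] in the cosine kernel on the uniform probability
    space [{0,1}^m]. *)
Definition density m (D : {set V * V}) : R :=
  (hom_sum D (@hamming_cos m))%:~R / ((2 ^ m) ^ #|V|)%:R.

Lemma density_ratio (a : nat) (c : int) l (D : {set V * V}) : (0 < a)%N ->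
   a%:Z * hom_sum D (@hamming_cos (4 * l)) <= c * (2 ^ #|V|)%:Z ^+ (4 * l) ->
   density (4 * l) D <= c%:~R / a%:R.
Proof.
move=> a0 H; rewrite /density expnAC natrX.
rewrite ler_pdivrMr ?exprn_gt0 ?ltr0n ?expn_gt0// mulrAC ler_pdivlMr ?ltr0n//.
by move: H; rewrite -(ler_int R) !rmorphM rmorphXn /= [X in X <= _]mulrC.
Qed.

Lemma density_le2 l D u v : oriented D -> joined D u v ->
  density (4 * l) D <= (4 ^+ l)^-1.
Proof.
move=> Dor uv.
have -> : (4 ^+ l)^-1 = 1%:~R / (4 ^ l)%:R :> R by rewrite natrX mul1r.
apply: density_ratio; first by rewrite expn_gt0.
have := hom_sum_le2 (2 * l) Dor uv; rewrite mulnA mul1r => /(le_trans _); apply.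
rewrite exprM -[2 ^+ 2]/4%:Z -PoszX.
by apply: ler_wpM2l; rewrite ?ler_norm.
Qed.

Lemma density_le4 l D u u' w w' : oriented D ->
  joined D u u' -> joined D w w' -> u != w -> ~~ joined D u w ->
  density (4 * l) D <= (4 ^+ l)^-1 ^+ 2.
Proof.
move=> Dor uu' ww' uw nuw.
have -> : (4 ^+ l)^-1 ^+ 2 = 1%:~R / (4 ^ (2 * l))%:R :> R.
  by rewrite exprVn -exprM mulnC natrX mul1r.
apply: density_ratio; first by rewrite expn_gt0.
have := hom_sum_le4 (2 * l) Dor uu' ww' uw nuw.
rewrite mulnA mul1r => /(le_trans _); apply.
by rewrite -[4]/4%:Z -PoszX; apply: ler_wpM2l; rewrite ?ler_norm.
Qed.

Lemma density_complete4 l D S' : odd l -> oriented D -> complete_on D S' ->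
  #|S'| = 4%N -> density (4 * l) D <= - (2 ^+ M)^-1 * (4 ^+ l)^-1.
Proof.
move=> lo Dor DS' S'4.
have -> : - (2 ^+ M)^-1 * (4 ^+ l)^-1 = (-1)%:~R / (2 ^ M * 4 ^ l)%:R :> R.
  by rewrite natrM !natrX invfM mulrA mulN1r.
apply: density_ratio; first by rewrite muln_gt0 !expn_gt0.
rewrite PoszM (PoszX 2 M) (PoszX 4 l) -mulrA mulN1r.
exact: hom_sum_complete4 DS' S'4.
Qed.

Lemma card_complete4 (K : {set V * V}) S :
  oriented K -> complete_on K S -> #|S| = 4%N -> #|K| = 6%N.
Proof.
move=> Kor KS S4; apply/eqP; rewrite -(eqn_pmul2l (isT : 0 < 2)%N) -(handshake Kor).
rewrite (bigID (mem S)) /= [X in (_ + X)%N]big1 ?addn0 => [|v vS]; last first.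
  by apply: eq_card0 => w; rewrite !inE KS (negbTE vS).
rewrite (eq_bigr (fun=> 3)) ?sum_nat_const ?S4// => v.
exact: complete_on_degree KS S4 v.
Qed.

(** More than six edges gain a factor [eps] over K4, and six or fewer gain a factor
    [(4^l)^-1] unless they form a K4, whose density is negative. *)
Lemma even_term_le l D (eps c : R) : odd l -> 0 < eps -> eps <= c -> c <= 1 ->
  (4 ^+ l)^-1 <= eps ^+ 6 * c ->
  oriented D -> D != set0 -> ~~ odd #|D| ->
  eps ^+ #|D| * density (4 * l) D <= eps ^+ 6 * c * (4 ^+ l)^-1.
Proof.
move=> lo eps0 epsc c1 lc Dor D0 Deven; set b := (4 ^+ l)^-1.
have b0 : 0 < b by rewrite invr_gt0 exprn_gt0.
have eps_ge0 := ltW eps0; have eps1 := le_trans epsc c1.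
have [D7|D6] := leqP 7 #|D|.
  have [[u v] uvD] := set0Pn _ D0.
  have uv : joined D u v by rewrite /joined uvD.
  apply: (@le_trans _ _ (eps ^+ #|D| * b)).
    by rewrite ler_wpM2l ?exprn_ge0// (density_le2 _ Dor uv).
  rewrite ler_wpM2r ?(ltW b0)//; apply: (@le_trans _ _ (eps ^+ 7)).
    exact: ler_wiXn2l.
  by rewrite exprSr ler_wpM2l ?exprn_ge0.
have [[S DS]|[u [u' [w [w' [uu' ww' uw nuw]]]]]] := complete_or_nonjoined Dor.
  have S4 := complete_on_card4 Dor DS D0 Deven D6.
  apply: (@le_trans _ _ 0).
    rewrite mulr_ge0_le0 ?exprn_ge0//.
    apply: le_trans (density_complete4 lo Dor DS S4) _.
    by rewrite mulNr oppr_le0 mulr_ge0 ?(ltW b0)// invr_ge0 exprn_ge0.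
  have c0 := le_trans eps_ge0 epsc.
  by rewrite (mulr_ge0 _ (ltW b0))// (mulr_ge0 _ c0)// exprn_ge0.
apply: (@le_trans _ _ (eps ^+ #|D| * b ^+ 2)).
  by rewrite ler_wpM2l ?exprn_ge0// (density_le4 _ Dor uu' ww' uw nuw).
apply: (@le_trans _ _ (1 * b ^+ 2)).
  by rewrite ler_wpM2r ?exprn_ge0 ?exprn_ile1// ltW.
by rewrite mul1r expr2 ler_wpM2r// ltW.
Qed.

Lemma exists_odd_inv_exp4 (x : R) : 0 < x -> exists2 l, odd l & (4 ^+ l)^-1 <= x.
Proof.
move=> x0; exists (Num.bound x^-1).*2.+1; first by rewrite /= odd_double.
rewrite -[leRHS]invrK lef_pV2 ?posrE ?invr_gt0 ?exprn_gt0//.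
apply: le_trans (ltW (archi_boundP _)) _; first by rewrite invr_ge0 ltW.
rewrite -natrX ler_nat (leq_trans _ (ltnW (ltn_expl _ _)))//.
by rewrite -addnn -addSn leq_addl.
Qed.

Lemma finite_counterexample (E K : {set V * V}) S (e0 : R) :
  oriented E -> K \subset E -> complete_on K S -> #|S| = 4%N ->
  0 < e0 -> exists eps m,
  [/\ 0 < eps, eps <= e0, eps <= 1 &
  hom_sum E (fun x y => 1 + eps * (@hamming_cos m x y)%:~R) +
  hom_sum E (fun x y => 1 - eps * (@hamming_cos m x y)%:~R) <
  2 * ((2 ^ m) ^ #|V|)%:R].
Proof.
move=> Eor KE KS S4 e0_gt0.
(* There are at most [q^-1] edge sets, each contributing at most
   [4 eps^6 c (4^l)^-1], against the gain [2 q eps^6 (4^l)^-1] from [K]; this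
   value of [c] makes their total half of that gain. *)
pose q : R := (2 ^+ M)^-1; pose c : R := q ^+ 2 / 4.
have q0 : 0 < q by rewrite invr_gt0 exprn_gt0.
have q1 : q <= 1 by rewrite invf_le1 ?exprn_gt0// exprn_ege1// ler1n.
have c0 : 0 < c by rewrite divr_gt0 ?exprn_gt0.
have c1 : c <= 1.
  by rewrite ler_pdivrMr// mul1r (le_trans (exprn_ile1 _ (ltW q0) q1))// ler1n.
pose eps : R := Num.min e0 c.
have eps0 : 0 < eps by rewrite lt_min e0_gt0.
have epsc : eps <= c by rewrite ge_min lexx orbT.
have eps1 : eps <= 1 := le_trans epsc c1.
have [l lo lc] : exists2 l, odd l & (4 ^+ l)^-1 <= eps ^+ 6 * c.
  by apply: exists_odd_inv_exp4; rewrite mulr_gt0 ?exprn_gt0.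
pose b : R := (4 ^+ l)^-1; have b0 : 0 < b by rewrite invr_gt0 exprn_gt0.
exists eps, (4 * l)%N; split=> //; first by rewrite ge_min lexx.
set m := (4 * l)%N; pose u x y : R := (@hamming_cos m x y)%:~R.
have -> : hom_sum E (fun x y => 1 - eps * u x y) =
    hom_sum E (fun x y => 1 + - eps * u x y).
  by apply: eq_bigr => x _; apply: eq_bigr => e _; rewrite mulNr.
rewrite !hom_sum_expand -big_split /=.
set N : R := ((2 ^ m) ^ #|V|)%:R; have N0 : 0 < N by rewrite ltr0n !expn_gt0.
rewrite -ltr_pdivrMr // mulr_suml.
have termE (D : {set V * V}) :
    (eps ^+ #|D| * hom_sum D u + (- eps) ^+ #|D| * hom_sum D u) / N =
    if odd #|D| then 0 else 2 * eps ^+ #|D| * density m D.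
  rewrite /density -/N -(hom_sum_rmorph intr) -/u exprNn -signr_odd.
  by case: odd; rewrite ?expr0 ?expr1; field; rewrite gt_eqF.
under eq_bigr do rewrite termE.
have Kor : oriented K := oriented_sub Eor KE.
have K6 := card_complete4 Kor KS S4.
have K0 : K != set0 by rewrite -card_gt0 K6.
rewrite (bigD1 set0) ?sub0set //= cards0 /= expr0 mulr1.
have -> : density m set0 = 1.
  rewrite /density -(hom_sum_rmorph intr) hom_sum0 card_ffun card_bool card_ord.
  by rewrite divff// gt_eqF.
rewrite mulr1 -[ltRHS]addr0 ltrD2l (bigD1 K) ?KE// K6 /=.
have Kle := density_complete4 lo Kor KS S4.
have e6cb : 0 <= eps ^+ 6 * c * b.
  by rewrite (mulr_ge0 _ (ltW b0))// (mulr_ge0 _ (ltW c0))// exprn_ge0// ltW.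
have others (D : {set V * V}) : D \subset E -> D != set0 ->
    (if odd #|D| then 0 else 2 * eps ^+ #|D| * density m D) <=
    4 * (eps ^+ 6 * c * b).
  move=> DE D0; case: ifPn => [_|Deven]; first exact: mulr_ge0.
  have Dor := oriented_sub Eor DE.
  have := even_term_le lo eps0 epsc c1 lc Dor D0 Deven.
  by rewrite -/b -/m -mulrA; lra.
have others_sum :
    \sum_(D : {set V * V} | (D \subset E) && (D != set0) && (D != K))
    (if odd #|D| then 0 else 2 * eps ^+ #|D| * density m D) <=
    q^-1 * (4 * (eps ^+ 6 * c * b)).
  apply: (@le_trans _ _ (\sum_(D : {set V * V}) 4 * (eps ^+ 6 * c * b))).
    rewrite big_mkcond; apply: ler_sum => D _.
    case: ifPn => [/andP[/andP[DE D0] _]|_]; first exact: others.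
    exact: mulr_ge0.
  rewrite sumr_const -[leLHS]mulr_natl.
  have -> : #|{set V * V}| = (2 ^ M)%N.
    by rewrite -cardsT -powersetT card_powerset cardsT.
  by rewrite natrX /q invrK.
have eb : 0 < eps ^+ 6 * b by rewrite mulr_gt0 ?exprn_gt0.
apply: le_lt_trans (lerD (lexx _) others_sum) _.
have -> : q^-1 * (4 * (eps ^+ 6 * c * b)) = q * (eps ^+ 6 * b).
  by rewrite /c; field; rewrite gt_eqF.
have : eps ^+ 6 * density m K <= eps ^+ 6 * (- q * b).
  by rewrite ler_wpM2l ?exprn_ge0// ltW.
have : 0 < q * (eps ^+ 6 * b) by rewrite mulr_gt0.
rewrite -mulrA.
have -> : eps ^+ 6 * (- q * b) = - (q * (eps ^+ 6 * b)) by ring.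
lra.
Qed.

End FiniteCounterexample.

(** * Step kernels on the unit interval *)

Section Box.
Local Open Scope classical_set_scope.
Local Open Scope ring_scope.
Context d (T : measurableType d) (R : realType).

Definition box n (c : 'I_n -> set T) : set (n.-tuple T) :=
  [set x | forall i, c i (tnth x i)].

Lemma measurable_box n (c : 'I_n -> set T) :
  (forall i, measurable (c i)) -> measurable (box c).
Proof.
move=> mc.
have -> : box c = \bigcap_(i in [set: 'I_n]) ((@tnth _ T ^~ i) @^-1` c i).
  by apply/seteqP; split=> [x xc i _|x xc i]; exact: xc.
apply: fin_bigcap_measurable => [|i _]; first exact: finite_finset.
by rewrite -[X in measurable X]classical_sets.setTI; exact: measurable_tnth.
Qed.

Lemma power_measure_box (P : probability T R) n (c : 'I_n -> set T)
    (p : 'I_n -> R) :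
  (forall i, measurable (c i)) -> (forall i, P (c i) = (p i)%:E) ->
  power_measure P n (box c) = (\prod_i p i)%:E.
Proof.
elim: n c p => [|n IHn] c p mc Pc.
  rewrite /= diracE big_ord0 mem_set // => -[] //.
have cE : @tuple_cons _ T n @^-1` box c =
    c ord0 `*` box (fun i => c (lift ord0 i)).
  apply/seteqP; split=> [[x y] /= H|[x y] /= [xc yc] i].
    split; first by have := H ord0; rewrite tnth0.
    by move=> i; have := H (lift ord0 i); rewrite tnthS.
  by have [j ->|->] := unliftP ord0 i; rewrite ?tnth0 ?tnthS.
rewrite /= /distribution /pushforward cE product_measure1E //;
  last exact: measurable_box.
rewrite [X in (_ * X)%E](IHn _ (fun i => p (lift ord0 i)))//.
by rewrite big_ord_recl EFinM; congr (_ * _)%E; exact: Pc.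
Qed.

(** On the cube over [D], a function that only depends on the cells of the
    coordinates is a finite combination of indicators of boxes, and all boxes have
    the same measure [p ^+ n]. *)
Lemma Rintegral_power_step (P : probability T R) (X : finType)
    (c : X -> set T) (p : R) n (h : {ffun 'I_n -> X} -> R)
    (D : set T) (f : n.-tuple T -> R) :
  measurable D ->
  (forall a, measurable (c a)) -> (forall a, P (c a) = p%:E) ->
  (forall a, c a `<=` D) ->
  (forall t, D t -> exists2 a, c a t & forall b, c b t -> b = a) ->
  (forall (s : {ffun 'I_n -> X}) x, box (c \o s) x -> f x = h s) ->
  \int[power_measure P n]_(x in box (fun=> D)) f x = (\sum_s h s) * p ^+ n.
Proof.
move=> mD mc Pc cD Dc fh; rewrite /Rintegral.
have mB (s : {ffun 'I_n -> X}) : measurable (box (c \o s) : set (n.-tuple T)).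
  by apply: measurable_box => i; exact: mc.
have mDn : measurable (box (fun=> D) : set (n.-tuple T)) by exact: measurable_box.
have fE x : box (fun=> D) x ->
    (f x)%:E =
    (\sum_(s : {ffun 'I_n -> X}) (h s)%:E * (\1_(box (c \o s)) x)%:E)%E.
  move=> Dx; pose s : {ffun 'I_n -> X} := [ffun i => sval (cid2 (Dc _ (Dx i)))].
  have xs : box (c \o s) x.
    by move=> i /=; rewrite ffunE; case: cid2.
  rewrite (bigD1 s) //= indicE mem_set// mule1 (fh _ _ xs) big1 ?adde0//.
  move=> s' s's; rewrite indicE memNset ?mule0// => xs'.
  move/eqP : s's; apply; apply/ffunP => i; rewrite ffunE.
  by case: cid2 => a /= _; apply; exact: xs'.
rewrite (eq_integral (fun x => \sum_(s : {ffun 'I_n -> X})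
    (h s)%:E * (\1_(box (c \o s)) x)%:E)%E); last first.
  by move=> x /set_mem; exact: fE.
have int1 (s : {ffun 'I_n -> X}) : (power_measure P n).-integrable (box (fun=> D))
    (fun x => (\1_(box (c \o s)) x)%:E).
  by apply: (integrableS measurableT) => //; exact: integrable_indic.
rewrite integral_sum //=; last by move=> s; exact: integrableZl.
rewrite (eq_bigr (fun s => (h s * p ^+ n)%:E)).
  by rewrite sumEFin /= mulr_suml.
move=> s _; rewrite integralZl // integral_indic //.
have -> : box (c \o s) `&` box (fun=> D) = box (c \o s).
  by apply/setIidl => x xs i; exact: cD (xs i).
have PB := power_measure_box (c := c \o s) (p := fun=> p)
  (fun i => mc (s i)) (fun i => Pc (s i)).
rewrite prodr_const card_ord in PB.
by rewrite EFinM; congr (_ * _)%E; exact: PB.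
Qed.

End Box.

Section Grid.
Local Open Scope classical_set_scope.
Local Open Scope ring_scope.
Variables (R : realType) (X : finType) (x0 : X).
Local Notation bR := (measurableTypeR R).

(** Cuts the unit interval into [#|X|] half-open intervals of equal length; the
    endpoint 1 falls outside the enumeration and receives the default [x0]. *)
Definition grid (t : bR) : X := nth x0 (enum X) (Num.truncn (t * #|X|%:R)).
Definition cell (a : X) : set bR := @unit_itv R `&` [set t | grid t = a].
Local Notation lo a := ((enum_rank a)%:R / #|X|%:R : R).
Local Notation hi a := ((enum_rank a).+1%:R / #|X|%:R : R).

Let X0 : 0 < #|X|%:R :> R.
Proof. by rewrite ltr0n; apply/card_gt0P; exists x0. Qed.

Lemma cell_interval a :
  cell a = [set` `[lo a, hi a[] `|` ([set 1] `&` [set t | grid t = a]).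
Proof.
apply/seteqP; split=> t.
  rewrite /cell /unit_itv /= in_itv /= => -[/andP[t0 t1] ta].
  have [t1E|tn1] := eqVneq t 1; [by right|left].
  have tX0 : 0 <= t * #|X|%:R by rewrite mulr_ge0.
  rewrite /= in_itv /= ler_pdivrMr// ltr_pdivlMr//.
  have tN : (Num.truncn (t * #|X|%:R) < #|X|)%N.
    by rewrite truncn_lt_nat// -[ltRHS]mul1r ltr_pM2r// lt_neqAle tn1.
  rewrite -truncn_eq // -ta.
  have -> : grid t = enum_val (Ordinal tN) by rewrite (enum_val_nth x0).
  by rewrite enum_valK.
rewrite /= => -[|[t1 ta]]; last first.
  by split=> //=; rewrite t1 /unit_itv /= in_itv /= ler01 lexx.
rewrite /= in_itv /= ler_pdivrMr// ltr_pdivlMr// => ta.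
have tN := truncn_def ta.
split; last first.
  by rewrite /= /grid tN -(enum_val_nth x0) enum_rankK.
rewrite /unit_itv /= in_itv /=; move: ta => /andP[ta1 ta2]; apply/andP; split.
  by rewrite -(pmulr_lge0 _ X0) (le_trans _ ta1).
rewrite -(ler_pM2r X0) mul1r (le_trans (ltW ta2))// ler_nat.
by rewrite ltn_ord.
Qed.

Lemma measurable_cell a : measurable (cell a).
Proof.
rewrite cell_interval; apply: measurableU; first exact: measurable_itv.
have [g1|g1] := eqVneq (grid 1) a.
  have -> : [set 1] `&` [set t | grid t = a] = [set 1].
    by apply/setIidl => t /= ->.
  exact: measurable_set1.
have -> : [set 1] `&` [set t | grid t = a] = classical_sets.set0;
  last exact: measurable0.
by rewrite -classical_sets.subset0 => t /= [-> /eqP]; rewrite (negbTE g1).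
Qed.

Lemma unit_measure_cell a : unit_measure R (cell a) = (#|X|%:R^-1)%:E.
Proof.
rewrite /unit_measure /mrestr.
have -> : cell a `&` [set` `[0, 1]] = cell a by apply/setIidl => t [].
have mI : measurable ([set 1] `&` [set t : bR | grid t = a]).
  have -> : [set 1] `&` [set t : bR | grid t = a] = cell a `&` [set 1].
    apply/seteqP; split=> t /=; rewrite /cell /=.
      move=> [t1 ta]; split=> //; split=> //.
      by rewrite t1 /unit_itv /= in_itv /= ler01 lexx.
    by move=> [[_ ->]].
  apply: measurableI; [exact: measurable_cell|exact: measurable_set1].
rewrite cell_interval measureU0//.
  have lohi : lo a < hi a by rewrite ltr_pM2r ?invr_gt0// ltr_nat.
  rewrite [LHS]lebesgue_measure_itv /= lte_fin lohi -EFinB.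
  by rewrite -mulrBl -natrB// subSnn mul1r.
apply/eqP; rewrite eq_le measure_ge0 andbT.
rewrite -[leRHS](lebesgue_measure_set1 (1 : R)).
by apply: le_measure; rewrite ?classical_sets.in_setE//; exact: measurable_set1.
Qed.

Definition step_kernel (w : X -> X -> R) (p : bR * bR) : R :=
  w (grid p.1) (grid p.2).

Lemma measurable_step_kernel w : measurable_fun (@unit_square R) (step_kernel w).
Proof.
move=> _ Y mY.
have -> : @unit_square R `&` step_kernel w @^-1` Y =
    \bigcup_(q in [set q : X * X | Y (w q.1 q.2)]) (cell q.1 `*` cell q.2).
  apply/seteqP; split=> [[x y] [[/= Ix Iy] wY]|].
    by exists (grid x, grid y).
  move=> [x y] [[a b] /= abY [[Ix gx] [Iy gy]]].
  by split=> //; rewrite /step_kernel /= /preimage /= gx gy.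
apply: fin_bigcup_measurable => [|q _]; first exact: finite_finset.
by apply: measurableX; exact: measurable_cell.
Qed.

Lemma step_kernel_is_kernel1 w : (forall a b, w a b = w b a) ->
  (forall a b, `|w a b| <= 1) -> is_kernel1 (step_kernel w).
Proof.
move=> wC w1; split; last by move=> p _; rewrite -ler_norml w1.
split; first exact: measurable_step_kernel.
  by move=> x y _; rewrite /step_kernel wC.
by exists 1 => p _; exact: w1.
Qed.

Lemma norm_oo_step_kernel w eps : 0 <= eps -> (forall a b, `|w a b| <= eps) ->
  (norm_oo (step_kernel w) <= eps%:E)%E.
Proof.
move=> eps0 weps; rewrite /norm_oo unlock.
case: ifP => _; last by rewrite lee_fin.
by apply/ess_supP/aeW => p /=; rewrite lee_fin weps.
Qed.

Definition edges (V : finType) (F : sgraph V) : {set V * V} :=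
  [set e | F e.1 e.2 && (enum_rank e.1 < enum_rank e.2)%N].

Lemma hom_density_step (V : finType) (F : sgraph V) (w : X -> X -> R) :
  hom_density F (step_kernel w) = hom_sum (edges F) w / (#|X| ^ #|V|)%:R.
Proof.
rewrite /hom_density natrX -exprVn.
pose h (s : {ffun 'I_#|V| -> X}) :=
  \prod_(e in edges F) w (s (enum_rank e.1)) (s (enum_rank e.2)).
rewrite (@Rintegral_power_step _ _ _ _ _ cell #|X|%:R^-1 _ h (@unit_itv R)) //=.
- congr (_ * _).
  pose tr (s : {ffun V -> X}) : {ffun 'I_#|V| -> X} := [ffun i => s (enum_val i)].
  rewrite (reindex tr) /=; last first.
    exists (fun s : {ffun 'I_#|V| -> X} => [ffun v => s (enum_rank v)]) => s _;
      by apply/ffunP => i; rewrite !ffunE ?enum_rankK ?enum_valK.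
  by apply: eq_bigr => s _; apply: eq_bigr => e _; rewrite !ffunE !enum_rankK.
- exact: measurable_itv.
- exact: measurable_cell.
- exact: unit_measure_cell.
- by move=> a t [].
- move=> t It; exists (grid t); first by split.
  by move=> b [].
- move=> s x xs; apply: eq_big => [e|e _]; first by rewrite inE.
  rewrite /step_kernel /=.
  by have [_ ->] := xs (enum_rank e.1); have [_ ->] := xs (enum_rank e.2).
Qed.

End Grid.

(** * Graphs that contain the complete graph on four nodes *)

Lemma edges_oriented (V : finType) (F : sgraph V) : oriented (edges F).
Proof.
move=> u v; rewrite !inE /= => /andP[_ uv].
by rewrite negb_and -leqNgt (ltnW uv) orbT.
Qed.

Lemma joined_edges (V : finType) (F : sgraph V) u v :
  joined (edges F) u v = F u v.
Proof.
rewrite /joined !inE /= (adj_sym F v u) -andb_orr.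
have [->|uv] := eqVneq u v; first by rewrite (adj_irr F).
by rewrite -neq_ltn -(inj_eq enum_rank_inj) in uv *; rewrite uv andbT.
Qed.

(** [K] keeps the edges of [F] between the images of the four nodes of K4. *)
Lemma complete4_subset_edges (V : finType) (F : sgraph V) :
  contains_subgraph F (complete_graph 4) ->
  exists (K : {set V * V}) (S : {set V}),
    [/\ K \subset edges F, complete_on K S & #|S| = 4%N].
Proof.
move=> [f [f_inj fF]]; pose S := [set f i | i : 'I_4].
pose K := [set e in edges F | (e.1 \in S) && (e.2 \in S)].
have memK u v : ((u, v) \in K) = [&& (u, v) \in edges F, u \in S & v \in S].
  by rewrite inE.
exists K, S; split.
- by apply/subsetP => -[u v]; rewrite memK => /andP[].
- move=> u v.
  have -> : joined K u v = [&& joined (edges F) u v, u \in S & v \in S].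
    by rewrite /joined !memK andb_orl (andbC (v \in S)).
  rewrite joined_edges andbC -andbA.
  have [/imsetP[i _ ->]|//] := boolP (u \in S).
  have [/imsetP[j _ ->]|//] := boolP (v \in S).
  rewrite /= (inj_eq f_inj); have [->|ij] := eqVneq i j; first by rewrite adj_irr.
  exact: fF.
- by rewrite card_imset// card_ord.
Qed.

Theorem theorem3p1 (R : realType) (V : finType) (F : sgraph V) :
  no_isolated_node F -> contains_subgraph F (complete_graph 4) ->
  ~ locally_common R F.
Proof.
move=> _ /complete4_subset_edges[K [S [KF KS S4]]] [e0 e0_gt0 Fcommon].
have [eps [m [eps0 eps_e0 eps1 lt2]]] :=
  finite_counterexample (@edges_oriented V F) KF KS S4 e0_gt0.
pose w (x y : {ffun 'I_m -> bool}) : R := eps * (hamming_cos x y)%:~R.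
have w_eps x y : `|w x y| <= eps.
  rewrite normrM gtr0_norm// ger_pMr// -intr_norm -[leRHS]/(1%:~R) ler_int.
  exact: hamming_cos_norm.
pose U := step_kernel [ffun=> false] w.
have UK : is_kernel1 U.
  apply: step_kernel_is_kernel1 => x y; first by rewrite /w hamming_cosC.
  exact: le_trans (w_eps x y) eps1.
have Ue0 : (norm_oo U <= e0%:E)%E.
  apply: norm_oo_step_kernel => [|x y]; first exact: ltW.
  exact: le_trans (w_eps x y) eps_e0.
have := Fcommon U UK Ue0.
rewrite (hom_density_step _ F (fun x y => 1 + w x y)).
rewrite (hom_density_step _ F (fun x y => 1 - w x y)).
have N0 : 0 < ((2 ^ m) ^ #|V|)%:R :> R by rewrite ltr0n !expn_gt0.
rewrite -mulrDl card_ffun card_bool card_ord ler_pdivlMr//.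
by apply/negP; rewrite -ltNge.
Qed.
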